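(* There exists a $12\times 11$ binary $3$-covering array, and any two $12\times 11$ binary $3$-covering arrays are equivalent.
   Context: A binary $t$-covering array of size $m$ and degree $n$ is an $m\times n$ matrix with entries in $\{0,1\}$ such that for any $t$ distinct columns, all $2^t$ binary vectors of length $t$ occur at least once as the restriction of some row to those columns. Two binary matrices are equivalent if one can be transformed into the other by a sequence of row permutations, column permutations, and complementations of individual columns (swapping $0$ and $1$ in that column). *)

(* Defs.v *)
From mathcomp Require Import all_boot all_fingroup all_algebra.

Set Implicit Arguments.
Unset Strict Implicit.
Unset Printing Implicit Defensive.

(* Choosing t distinct columns is choosing an injection f : 'I_t -> 'I_n. *)
Definition covering_array (t m n : nat) (A : 'M[bool]_(m, n)) : Prop :=
  forall f : 'I_t -> 'I_n, injective f ->
  forall v : 'rV[bool]_t, exists i : 'I_m, row i (colsub f A) = v.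

Definition col_compl (m n : nat) (j : 'I_n) (A : 'M[bool]_(m, n)) :
    'M[bool]_(m, n) :=
  \matrix_(i, k) (if k == j then ~~ A i k else A i k).

Inductive mx_equiv (m n : nat) (A : 'M[bool]_(m, n)) : 'M[bool]_(m, n) -> Prop :=
| mx_equiv_refl : mx_equiv A A
| mx_equiv_row_perm (B : 'M[bool]_(m, n)) (s : 'S_m) :
    mx_equiv A B -> mx_equiv A (row_perm s B)
| mx_equiv_col_perm (B : 'M[bool]_(m, n)) (s : 'S_n) :
    mx_equiv A B -> mx_equiv A (col_perm s B)
| mx_equiv_col_compl (B : 'M[bool]_(m, n)) (j : 'I_n) :
    mx_equiv A B -> mx_equiv A (col_compl j B).

(* Main.v *)
Require Import Defs.
From mathcomp Require Import all_boot all_fingroup all_algebra.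
From mathcomp Require Import zify.

Set Implicit Arguments.
Unset Strict Implicit.
Unset Printing Implicit Defensive.

Import GRing.Theory Num.Theory.

(* Fix a column and a value occurring in at most 6 rows of it. If another column took some
   value at most twice on these rows, the remaining 9 columns would give pairwise incomparable
   subsets of a 4-element set, which is impossible. Hence any two columns take each pair of
   values exactly 3 times, the array bordered by a column of ones is a Hadamard matrix, and any
   two rows differ in exactly 6 places. After complementing columns so that row 0 is constant
   and permuting columns so that row 1 is 1^5 0^6, the other rows restrict to the ten pairs of
   the first five columns, i.e. to the edges of K5, and each of the last six columns selects the
   edges of a 5-cycle of K5, any two of these sharing two edges. The twelve 5-cycles fall into
   two classes of six, distinct cycles sharing two edges exactly when they are in the same class.
   So the last columns form one of the two classes, and a transposition of vertices exchanges
   them. *)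

(** * Matrix equivalence *)

Lemma mx_equiv_trans m n (A B C : 'M[bool]_(m, n)) :
  mx_equiv A B -> mx_equiv B C -> mx_equiv A C.
Proof.
by move=> AB; elim=> // *; [apply: mx_equiv_row_perm | apply: mx_equiv_col_perm
  | apply: mx_equiv_col_compl].
Qed.

Lemma col_complK m n (j : 'I_n) : involutive (@col_compl m n j).
Proof. by move=> A; apply/matrixP=> i k; rewrite !mxE; case: eqP; rewrite ?negbK. Qed.

Lemma mx_equiv_sym m n (A B : 'M[bool]_(m, n)) : mx_equiv A B -> mx_equiv B A.
Proof.
elim=> [|C s _ IH|C s _ IH|C j _ IH]; first exact: mx_equiv_refl.
- apply: mx_equiv_trans IH.
  have {2}-> : C = row_perm s^-1%g (row_perm s C) by rewrite -row_permM mulVg row_perm1.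
  exact/mx_equiv_row_perm/mx_equiv_refl.
- apply: mx_equiv_trans IH.
  have {2}-> : C = col_perm s^-1%g (col_perm s C) by rewrite -col_permM mulVg col_perm1.
  exact/mx_equiv_col_perm/mx_equiv_refl.
- apply: mx_equiv_trans IH; rewrite -{2}[C](col_complK j).
  exact/mx_equiv_col_compl/mx_equiv_refl.
Qed.

(** A choice function for [P] is injective by the second hypothesis, hence a permutation since [T]
    is finite. *)
Lemma perm_of_rel (T : finType) (P : T -> T -> Prop) :
  (forall i, exists k, P i k) -> (forall i j k, P i k -> P j k -> i = j) ->
  exists s : {perm T}, forall i, P i (s i).
Proof.
move=> /fin_all_exists[f Pf] Pinj.
have f_inj : injective f by move=> i j fij; apply: (Pinj _ _ (f i)); rewrite // fij.
by exists (perm f_inj) => i; rewrite permE.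
Qed.

Lemma mx_equiv_cols m n (A B : 'M[bool]_(m, n)) :
    injective (fun j => col j B) -> (forall j, exists k, col j B = col k A) ->
  mx_equiv A B.
Proof.
move=> Binj /perm_of_rel[j k l Ej Ek|s BA]; first by apply: Binj; rewrite /= Ej Ek.
have -> : B = col_perm s A.
  by apply/matrixP=> i j; move/colP: (BA j) => /(_ i); rewrite !mxE.
exact/mx_equiv_col_perm/mx_equiv_refl.
Qed.

Definition compl_cols m n (c : pred 'I_n) (A : 'M[bool]_(m, n)) : 'M[bool]_(m, n) :=
  (\matrix_(i, j) (A i j (+) c j))%R.

Lemma mx_equiv_compl m n (A : 'M[bool]_(m, n)) (c : pred 'I_n) : mx_equiv A (compl_cols c A).
Proof.
(* Complementing along a list flips a column once per occurrence, so only parities matter; a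
   repetition-free list of the columns in [c] then gives [c]. *)
have E s : mx_equiv A (compl_cols (fun j => odd (count_mem j s)) A).
  elim: s => [|k s IH].
    suff -> : compl_cols (fun j => odd (count_mem j [::])) A = A by apply: mx_equiv_refl.
    by apply/matrixP=> i j; rewrite mxE addbF.
  suff -> : compl_cols (fun j => odd (count_mem j (k :: s))) A =
            col_compl k (compl_cols (fun j => odd (count_mem j s)) A).
    exact: mx_equiv_col_compl.
  apply/matrixP=> i j; rewrite !mxE /= oddD oddb [j == k]eq_sym.
  by case: (k == j) => //; rewrite addTb addbN.
suff -> : compl_cols c A = compl_cols (fun j => odd (count_mem j [seq k <- enum 'I_n | c k])) A.
  exact: E.
apply/matrixP=> i j; rewrite !mxE count_uniq_mem ?filter_uniq -?enumT ?enum_uniq //.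
by rewrite mem_filter mem_enum andbT oddb.
Qed.

(** * Covering triples of columns, entrywise *)

Definition covering3 m n (A : 'M[bool]_(m, n)) : Prop :=
  forall j k l, uniq [:: j; k; l] ->
  forall x y z, exists i, [/\ A i j = x, A i k = y & A i l = z].

Lemma covering3P m n (A : 'M[bool]_(m, n)) : covering_array 3 A <-> covering3 A.
Proof.
split=> [covA j k l jkl x y z|covA f f_inj v].
  have /tuple_uniqP f_inj : uniq [tuple j; k; l] by [].
  have [i /rowP iE] := covA _ f_inj (\row_i tnth [tuple x; y; z] i)%R.
  by exists i; split; [have := iE ord0 | have := iE (inord 1) | have := iE (inord 2)];
    rewrite !mxE !(tnth_nth j, tnth_nth x) /= ?inordK.
have [|i [i0 i1 i2]] := covA (f ord0) (f (inord 1)) (f (inord 2)) _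
  (v ord0 ord0) (v ord0 (inord 1)) (v ord0 (inord 2)).
  by rewrite /= !inE !(inj_eq f_inj) -!val_eqE /= !inordK.
exists i; apply/rowP=> j; rewrite !mxE.
have : j \in [:: ord0; inord 1; inord 2].
  by rewrite !inE -!val_eqE /= !inordK //; case: j => [[|[|[]]]].
by rewrite !inE => /or3P[] /eqP->.
Qed.

Lemma covering3_equiv m n (A B : 'M[bool]_(m, n)) :
  mx_equiv A B -> covering3 A -> covering3 B.
Proof.
move=> AB covA; elim: AB => // [C s _ covC|C s _ covC|C h _ covC] j k l jkl x y z.
- have [i iE] := covC j k l jkl x y z.
  by exists (s^-1%g i); rewrite !mxE permKV.
- have [|i iE] := covC (s j) (s k) (s l) _ x y z.
    by rewrite /= !inE !(inj_eq perm_inj) in jkl *.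
  by exists i; rewrite !mxE.
- have [i [ij ik il]] := covC j k l jkl (x (+) (j == h)) (y (+) (k == h)) (z (+) (l == h)).
  exists i; rewrite !mxE ij ik il.
  by split; case: (_ == h); rewrite ?addbT ?negbK ?addbF.
Qed.

(** * Orthogonality of the columns *)

Lemma triple_half_ge m (A : 'M[bool]_(m, 11)) (j k : 'I_11) b x :
    covering3 A -> j != k -> #|[set i | A i j == b]| <= 6 ->
  3 <= #|[set i | (A i j == b) && (A i k == x)]|.
Proof.
move=> covA jk; set R := [set i | A i j == b] => R6.
set S := [set i | _]; rewrite leqNgt ltnS; apply/negP=> S2.
pose L := ~: [set j; k].
have L9 : #|L| = 9 by have := cardsC [set j; k]; rewrite cards2 jk card_ord => -[].
have inL l : l \in L -> (j != l) && (k != l).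
  by rewrite !inE negb_or eq_sym [l == k]eq_sym.
have covS l y : l \in L -> exists2 i, i \in S & A i l = y.
  case/inL/andP=> jl kl.
  have [|i [ij ik il]] := covA j k l _ b x y; first by rewrite /= !inE negb_or jk jl kl.
  by exists i; rewrite // inE ij ik !eqxx.
have [l0 l0L] : exists l, l \in L by apply/card_gt0P; rewrite L9.
have [p pS pl0] := covS l0 false l0L; have [q qS ql0] := covS l0 true l0L.
have pq : p != q by apply/eqP=> pq; rewrite pq ql0 in pl0.
have SE : S = [set p; q].
  by apply/esym/eqP; rewrite eqEcard cards2 pq subUset !sub1set pS qS S2.
(* Every further column takes both values on [S], which has just two rows, so rows [p] and [q] are
   complementary on [L]. *)
have Aq l : l \in L -> A q l = ~~ A p l.
  move=> lL; have [i] := covS l (~~ A p l) lL.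
  by rewrite SE !inE => /orP[]/eqP-> // /esym/eqP; rewrite eqb_negLR; case: (A p l).
pose Q := R :\: S.
have Q4 : #|Q| <= 4.
  have sSR : S \subset R by apply/subsetP=> i; rewrite !inE => /andP[].
  by rewrite /Q cardsDS // SE cards2 pq leq_subLR.
pose D l := [set i in Q | A i l != A p l].
have crossD l l' : l \in L -> l' \in L -> l != l' -> exists2 i, i \in D l & i \notin D l'.
  move=> lL l'L ll'; have /andP[jl _] := inL _ lL; have /andP[jl' _] := inL _ l'L.
  (* The requested row differs from [p] in column [l] and from [q] in column [l'], so it lies
     outside [S]. *)
  have [|i [ij il il']] := covA j l l' _ b (~~ A p l) (A p l').
    by rewrite /= !inE negb_or jl jl' ll'.
  exists i; last by rewrite !inE il' eqxx andbF.
  rewrite inE il in_setD SE !inE ij eqxx andbT negb_or -andbA; apply/and3P; split.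
  - by apply/eqP=> ip; rewrite ip in il; case: (A p l) il.
  - by apply/eqP=> iq; rewrite iq Aq // in il'; case: (A p l') il'.
  - by case: (A p l).
have [q0 Q3] : exists q0, #|Q :\ q0| <= 3.
  (* If [Q] is empty any point will do; [p] is a mere default. *)
  case: (set_0Vmem Q) => [->|[q0 q0Q]]; first by exists p; rewrite set0D cards0.
  by exists q0; rewrite (cardsD1 q0) q0Q in Q4.
(* Sets that agree off one point are nested, while the [D l] are pairwise incomparable. *)
have D_inj : {in L &, injective (fun l => D l :\ q0)}.
  have sub l l' i : D l :\ q0 = D l' :\ q0 -> i \in D l -> i \notin D l' -> i = q0.
    move=> Dll' iD iD'; apply/eqP/negPn/negP=> iq.
    by have := in_setD1 i (D l) q0; rewrite Dll' in_setD1 iq iD (negPf iD').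
  move=> l l' lL l'L Dll'; apply/eqP/negPn/negP=> ll'.
  have [i iD iD'] := crossD _ _ lL l'L ll'.
  have [|i' i'D' i'D] := crossD _ _ l'L lL; first by rewrite eq_sym.
  have iq := sub _ _ _ Dll' iD iD'; have i'q := sub _ _ _ (esym Dll') i'D' i'D.
  by rewrite iq -i'q i'D' in iD'.
have : #|L| <= #|powerset (Q :\ q0)|.
  rewrite -(card_in_imset D_inj) subset_leq_card //; apply/subsetP=> _ /imsetP[l _ ->].
  by rewrite inE setSD //; apply/subsetP=> i; rewrite inE => /andP[].
rewrite L9 card_powerset; apply/negP; rewrite -ltnNge ltnS.
by rewrite -[8]/(2 ^ 3) leq_exp2l.
Qed.

(** Some value of column [j] occurs at most 6 times. By the previous bound it occurs at least 3 + 3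
    times, so both values occur 6 times, and the bound applies to each: both split as 3 + 3. *)
Lemma cols_orthogonal (A : 'M[bool]_(12, 11)) (j k : 'I_11) b x :
  covering3 A -> j != k -> #|[set i | (A i j == b) && (A i k == x)]| = 3.
Proof.
move=> covA jk; pose N b x := #|[set i | (A i j == b) && (A i k == x)]|.
pose C b := #|[set i | A i j == b]|.
have CE c : C c = N c true + N c false.
  rewrite /C -(cardsID [set i | A i k]); congr (_ + _); apply: eq_card => i.
    by rewrite !inE eqb_id.
  by rewrite !inE eqbF_neg andbC.
have C12 : C true + C false = 12.
  rewrite -[RHS](card_ord 12) -(cardsC [set i | A i j]); congr (_ + _); apply: eq_card => i.
    by rewrite !inE eqb_id.
  by rewrite !inE eqbF_neg.
have N3 c y : C c <= 6 -> 3 <= N c y by exact: triple_half_ge.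
have := N3 true true; have := N3 true false; have := N3 false true; have := N3 false false.
have := CE true; have := CE false; rewrite -/(N b x).
by case: b; case: x; lia.
Qed.

(** * From columns to rows: the Hadamard argument *)

Lemma card_set_sum n (P : pred 'I_n) : #|[set i | P i]| = \sum_i P i.
Proof.
by rewrite cardsE -sum1_card big_mkcond; apply: eq_bigr => i _; rewrite unfold_in; case: (P i).
Qed.

Lemma sum_sign n (P : pred 'I_n) :
  (\sum_i (-1) ^+ P i = n%:R - (2 * \sum_i P i)%:R :> rat)%R.
Proof.
rewrite (eq_bigr (fun i => 1 - (2 * P i)%:R : rat)%R) => [|i _]; last by case: (P i).
by rewrite sumrB sumr_const card_ord -natr_sum -big_distrr.
Qed.

Lemma sum_col (A : 'M[bool]_(12, 11)) (j : 'I_11) : covering3 A -> \sum_i A i j = 6.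
Proof.
move=> covA; have [k jk] : exists k, j != k.
  by exists (if j == ord0 then ord_max else ord0); case: (eqVneq j ord0) => [->|].
have := cols_orthogonal true true covA jk; have := cols_orthogonal true false covA jk.
rewrite !card_set_sum (_ : \sum_i A i j = \sum_i ((A i j == true) && (A i k == false)) +
  \sum_i ((A i j == true) && (A i k == true))) => [->->//|].
by rewrite -big_split; apply: eq_bigr => i _; case: (A i j); case: (A i k).
Qed.

Lemma sum_col_add (A : 'M[bool]_(12, 11)) (j k : 'I_11) :
  covering3 A -> j != k -> \sum_i (A i j (+) A i k) = 6.
Proof.
move=> covA jk.
have := cols_orthogonal false true covA jk; have := cols_orthogonal true false covA jk.
rewrite !card_set_sum (_ : \sum_i (A i j (+) A i k) =
  \sum_i ((A i j == true) && (A i k == false)) +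
  \sum_i ((A i j == false) && (A i k == true))) => [->->//|].
by rewrite -big_split; apply: eq_bigr => i _; case: (A i j); case: (A i k).
Qed.

Lemma sum_col_and (A : 'M[bool]_(12, 11)) (j k : 'I_11) :
  covering3 A -> j != k -> \sum_i (A i j && A i k) = 3.
Proof.
move=> covA jk; apply: etrans (cols_orthogonal true true covA jk).
by rewrite card_set_sum; apply: eq_bigr => i _; rewrite !eqb_id.
Qed.

(* The matrix with entries [(-1) ^+ A i j], bordered by a column of ones, is a Hadamard
   matrix, so that orthogonality passes from its columns to its rows. *)
Lemma sum_row_add (A : 'M[bool]_(12, 11)) (i i' : 'I_12) :
  covering3 A -> i != i' -> \sum_j (A i j (+) A i' j) = 6.
Proof.
move=> covA ii'.
pose a i (j : 'I_12) := oapp (A i) false (unlift ord0 j).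
pose H : 'M[rat]_12 := (\matrix_(i, j) (-1) ^+ a i j)%R.
have a0 r : a r ord0 = false by rewrite /a unlift_none.
have aS r j : a r (lift ord0 j) = A r j by rewrite /a liftK.
(* Against the border column, which is constantly [false], this says that each column has six
   ones. *)
have aa j k : j != k -> \sum_r (a r j (+) a r k) = 6.
  case: (unliftP ord0 j) => [j'|] ->; case: (unliftP ord0 k) => [k'|] -> //.
  - rewrite (inj_eq lift_inj) => jk; apply: etrans (sum_col_add covA jk).
    by apply: eq_bigr => r _; rewrite !aS.
  - by move=> _; apply: etrans (sum_col j' covA); apply: eq_bigr => r _; rewrite aS a0 addbF.
  - by move=> _; apply: etrans (sum_col k' covA); apply: eq_bigr => r _; rewrite aS a0.
have HtH : (H^T *m (12%:R^-1 *: H) = 1%:M)%R.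
  rewrite -scalemxAr; apply/matrixP=> j k; rewrite !mxE.
  rewrite (eq_bigr (fun r => (-1) ^+ (a r j (+) a r k)))%R => [|r _]; last first.
    by rewrite !mxE signr_addb.
  rewrite sum_sign; case: (eqVneq j k) => [->|jk]; last by rewrite aa // subrr mulr0.
  by rewrite big1 ?subr0 ?mulVf ?pnatr_eq0 // => r _; rewrite addbb.
(* A left inverse of a square matrix is a right inverse; an off-diagonal entry of the reversed
   product then gives 12 = 2 * (number of differences). *)
move/mulmx1C/matrixP/(_ i i'): HtH; rewrite -scalemxAl !mxE (negPf ii').
rewrite (eq_bigr (fun j => (-1) ^+ (a i j (+) a i' j)))%R => [|j _]; last first.
  by rewrite !mxE signr_addb.
rewrite sum_sign big_ord_recl !a0 (eq_bigr (fun j => nat_of_bool (A i j (+) A i' j))); last first.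
  by move=> j _; rewrite !aS.
move/eqP; rewrite mulf_eq0 invr_eq0 pnatr_eq0 /= subr_eq0 eqr_nat.
by rewrite add0n -[12]/(2 * 6) eqn_pmul2l // => /eqP.
Qed.

(** Equal columns would share six ones instead of three. *)
Lemma col_inj (A : 'M[bool]_(12, 11)) : covering3 A -> injective (fun j => col j A).
Proof.
move=> covA j k /colP Ajk; apply/eqP/negPn/negP=> jk.
have := sum_col_and covA jk; rewrite (eq_bigr (fun i => nat_of_bool (A i j))) ?sum_col //.
by move=> i _; have := Ajk i; rewrite !mxE => <-; rewrite andbb.
Qed.

(** * Normalizing the first two rows *)

Lemma perm_eq_bool (s t : seq bool) : size s = size t -> count id s = count id t -> perm_eq s t.
Proof.
move=> size_st count_st; apply/seq.permP=> a.
have countE u : count a u = a true * count id u + a false * (size u - count id u).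
  elim: u => [|b u /= ->]; first by rewrite !muln0.
  by have := count_size id u; case: b => /=; case: (a true); case: (a false); lia.
by rewrite !countE size_st count_st.
Qed.

(** Indexing by natural numbers lets concrete rows and columns be handled by evaluation; [inord]
    reads an out-of-range index as 0. *)
Definition entry (A : 'M[bool]_(12, 11)) (i j : nat) : bool := A (inord i) (inord j).

Definition col_seq A j := [seq entry A i j | i <- iota 0 12].

Lemma entryE A (i : 'I_12) (j : 'I_11) : entry A i j = A i j.
Proof. by rewrite /entry !inord_val. Qed.

Lemma entry_sum_row A i k : covering3 A -> i < 12 -> k < 12 -> i != k ->
  \sum_(j < 11) (entry A i j (+) entry A k j) = 6.
Proof.
move=> covA i12 k12 ik; apply: etrans (sum_row_add covA (_ : inord i != inord k)).
  by apply: eq_bigr => j _; rewrite /entry inord_val.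
by rewrite -val_eqE /= !inordK.
Qed.

Lemma entry_sum_col A j k : covering3 A -> j < 11 -> k < 11 -> j != k ->
  \sum_(i < 12) (entry A i j && entry A i k) = 3.
Proof.
move=> covA j11 k11 jk; apply: etrans (sum_col_and covA (_ : inord j != inord k)).
  by apply: eq_bigr => i _; rewrite /entry inord_val.
by rewrite -val_eqE /= !inordK.
Qed.

Lemma exists_row0 A : exists2 B, mx_equiv A B & forall j, entry B 0 j.
Proof.
exists (compl_cols (fun j => ~~ A (inord 0) j) A); first exact: mx_equiv_compl.
by move=> j; rewrite /entry mxE; case: (A _ _).
Qed.

(** Row 1 differs from the all-ones row 0 in six of 11 places, so it has five ones, which a column
    permutation brings to the front. *)
Lemma exists_row1 A : covering3 A -> (forall j, entry A 0 j) ->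
  exists B, [/\ mx_equiv A B, forall j, entry B 0 j & forall j, j < 11 -> entry B 1 j = (j < 5)].
Proof.
move=> covA A0.
have /tuple_permP[s sE] : perm_eq [tuple (j : 'I_11) < 5 | j < 11] [tuple A (inord 1) j | j < 11].
  apply: perm_eq_bool; first by rewrite !size_tuple.
  have countE (f : 'I_11 -> bool) : count id [tuple f j | j < 11] = \sum_j f j.
    rewrite count_map -sum1_count big_enum_cond big_mkcond.
    by apply: eq_bigr => j _ /=; case: (f j).
  rewrite !countE; have E6 := entry_sum_row covA (isT : 0 < 12) (isT : 1 < 12) isT.
  have E11 : \sum_(j < 11) (entry A 0 j (+) entry A 1 j) + \sum_j A (inord 1) j = 11.
    rewrite -big_split -[RHS](card_ord 11) -sum1_card; apply: eq_bigr => j _.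
    by rewrite A0 /entry inord_val; case: (A _ j).
  rewrite E6 in E11; apply/(@addnI 6)/(etrans _ (esym E11)).
  by rewrite !big_ord_recr big_ord0.
exists (col_perm s A); split; first exact/mx_equiv_col_perm/mx_equiv_refl.
  by move=> j; have := A0 (s (inord j)); rewrite /entry mxE inord_val.
move=> j j11; rewrite /entry mxE.
have /(congr1 (fun u => nth false u j)) := sE.
by rewrite -!(tnth_nth _ _ (Ordinal j11)) !tnth_mktuple /= => ->; rewrite (inord_val (Ordinal j11)).
Qed.

(** * The first five columns and the edges of K5 *)

Definition edges := [:: (0, 1); (0, 2); (0, 3); (0, 4); (1, 2);
                        (1, 3); (1, 4); (2, 3); (2, 4); (3, 4)].

Definition star k := [seq (k == e.1) || (k == e.2) | e <- edges].

(** For [i] at least 2 this is the incidence vector of edge number [i - 2]; rows 0 and 1 are all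
    ones. *)
Definition row5 i := [seq nth false (true :: true :: star j) i | j <- iota 0 5].

(** With x ones among the first five entries and y among the last six, the distances to rows 0 and 1
    give (5 - x) + (6 - y) = 6 and (5 - x) + y = 6, so x = 2. *)
Lemma row5_sum A k : covering3 A -> (forall j, entry A 0 j) ->
    (forall j, j < 11 -> entry A 1 j = (j < 5)) -> 1 < k < 12 ->
  \sum_(j < 5) entry A k j = 2.
Proof.
move=> covA A0 A1 /andP[k1 k12].
have splitE (f : nat -> bool) :
    \sum_(j < 11) f j = \sum_(j < 5) f j + \sum_(j < 6) f (5 + j).
  exact: (@big_split_ord _ _ _ 5 6 xpredT (fun j => nat_of_bool (f j))).
have addT n (f : nat -> bool) : \sum_(j < n) (true (+) f j) + \sum_(j < n) f j = n.
  rewrite -big_split -[RHS]card_ord -sum1_card.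
  by apply: eq_bigr => j _; case: (f j).
have E1 : \sum_(j < 5) (true (+) entry A k j) + \sum_(j < 6) entry A k (5 + j) = 6.
  apply: etrans (entry_sum_row covA (isT : 1 < 12) k12 (negbT (ltn_eqF k1))).
  rewrite (splitE (fun j => entry A 1 j (+) entry A k j)); congr (_ + _).
    by apply: eq_bigr => j _; rewrite A1 ?ltn_ord // (ltn_trans (ltn_ord j)).
  by apply: eq_bigr => j _; rewrite A1 ?(ltn_add2l 5 j 6) ?ltn_ord // ltnNge leq_addr.
have E0 : \sum_(j < 5) (true (+) entry A k j) + \sum_(j < 6) (true (+) entry A k (5 + j)) = 6.
  apply: etrans (entry_sum_row covA (isT : 0 < 12) k12 (negbT (ltn_eqF (ltnW k1)))).
  rewrite (splitE (fun j => entry A 0 j (+) entry A k j)).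
  by congr (_ + _); apply: eq_bigr => j _; rewrite A0.
have := addT 5 (entry A k); have := addT 6 (fun j => entry A k (5 + j)); lia.
Qed.

(** Two of the first five columns share three ones: rows 0 and 1 and one further row, which has no
    other ones among these five columns. So every edge occurs as a row. *)
Lemma exists_edge_rows A : covering3 A -> (forall j, entry A 0 j) ->
    (forall j, j < 11 -> entry A 1 j = (j < 5)) ->
  exists B, [/\ mx_equiv A B, forall k, k < 5 -> col_seq B k = true :: true :: star k
    & forall j, 5 <= j < 11 -> exists w, col_seq B j = true :: false :: w].
Proof.
move=> covA A0 A1.
have row5_edge i : 2 <= i < 12 ->
    exists2 e, e \in edges & row5 i = [seq (j == e.1) || (j == e.2) | j <- iota 0 5].
  move=> i12; suff /hasP[e eE /eqP] : has (fun e =>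
    row5 i == [seq (j == e.1) || (j == e.2) | j <- iota 0 5]) edges by exists e.
  have /allP all_row : all (fun i => has (fun e =>
    row5 i == [seq (j == e.1) || (j == e.2) | j <- iota 0 5]) edges) (iota 2 10) by [].
  by apply: all_row; rewrite mem_iota.
have [i|i i' k [ki Hi] [ki' Hi']|s sP] := @perm_of_rel 'I_12
    (* The second clause pins rows 0 and 1, which [row5] does not tell apart. *)
    (fun i k => [seq entry A k j | j <- iota 0 5] = row5 i /\ (i < 2 -> k = i)).
- have [i2|i2] := ltnP i 2.
    exists i; split=> //.
    have A01 j : j \in iota 0 5 -> entry A i j.
      rewrite mem_iota => /= j5; case: i i2 => -[|[|]] //= _ _.
      by rewrite A1 // (ltn_trans j5).
    have -> : row5 i = [seq true | j <- iota 0 5] by case: i i2 A01 => [[|[|]]].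
    by apply/eq_in_map.
  have [|[a b] ab ->] := row5_edge i; first by rewrite i2 ltn_ord.
  have /and3P[a5 b5 nab] : [&& a < 5, b < 5 & a != b].
    have /allP/(_ _ ab) // : all (fun e => [&& e.1 < 5, e.2 < 5 & e.1 != e.2]) edges by [].
  have [k /and3P[k2 ka kb]] : exists k : 'I_12, [&& 1 < k, entry A k a & entry A k b].
    have a11 := ltn_trans a5 (isT : 5 < 11); have b11 := ltn_trans b5 (isT : 5 < 11).
    have := entry_sum_col covA a11 b11 nab.
    rewrite 2!big_ord_recl /= !A0 !A1 // a5 b5 => E.
    have /existsP[k kab] : [exists k : 'I_10, entry A k.+2 a && entry A k.+2 b].
      rewrite -[[exists _, _]]negbK negb_exists; apply/negP=> /forallP N.
      by move: E; rewrite big1 // => k _; apply/eqP; rewrite eqb0; have := N k.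
    by exists (lift ord0 (lift ord0 k)).
  exists k; split=> //.
  apply/eq_in_map => j; rewrite mem_iota /= add0n => j5.
  have := row5_sum covA A0 A1 (introT andP (conj k2 (ltn_ord k))).
  rewrite (bigD1 (Ordinal a5)) // ka (bigD1 (Ordinal b5)) /=; last by rewrite eq_sym.
  rewrite kb; have [->|ja] := eqVneq j a; first by rewrite ka.
  have [->|jb] := eqVneq j b; first by rewrite kb.
  by rewrite (bigD1 (Ordinal j5)) /= -?val_eqE /= ?ja ?jb //; case: (entry A k j).
- have : row5 i == row5 i' by rewrite -ki -ki'.
  move=> Eii'; have : (i == i' :> nat) || (i < 2) && (i' < 2).
    have /allP row5_inj : all (fun i => all (fun i' => (row5 i == row5 i') ==>
      (i == i') || (i < 2) && (i' < 2)) (iota 0 12)) (iota 0 12) by [].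
    have in12 (l : 'I_12) : (l : nat) \in iota 0 12 by rewrite mem_iota /=.
    by have /allP/(_ _ (in12 i'))/implyP/(_ Eii') := row5_inj _ (in12 i).
  by case/orP=> [/eqP/val_inj|/andP[/Hi <- /Hi' <-]].
have entryB i j : i < 12 -> entry (row_perm s A) i j = entry A (s (inord i)) j.
  by move=> i12; rewrite /entry mxE inord_val.
exists (row_perm s A); split; first exact/mx_equiv_row_perm/mx_equiv_refl.
- move=> k k5.
  have -> : true :: true :: star k =
      [seq nth false (true :: true :: star k) i | i <- iota 0 12].
    by [].
  apply/eq_in_map=> i; rewrite mem_iota => i12; rewrite entryB //.
  have [/(congr1 (fun u => nth false u k))] := sP (inord i).
  by rewrite /row5 !(nth_map 0) ?size_iota // nth_iota // inordK.
- have sE i : i < 2 -> s (inord i) = inord i.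
    by move=> i2; have [_ ->] := sP (inord i); rewrite ?inordK //; apply: ltn_trans i2 _.
  move=> j /andP[j5 j11]; rewrite /col_seq /= !entryB // (sE 0) // (sE 1) //.
  have := A0 j; have := A1 j j11; rewrite ltnNge j5 /entry !inordK // => -> ->.
  by eexists.
Qed.

(** * The last six columns and the 5-cycles of K5 *)

Definition share (u v : seq bool) := count (fun p => p.1 && p.2) (zip u v).

Lemma share_col_seq A j k : covering3 A -> j < 11 -> k < 11 -> j != k ->
  share (col_seq A j) (col_seq A k) = 3.
Proof.
move=> covA j11 k11 jk; apply: etrans (entry_sum_col covA j11 k11 jk).
rewrite /share zip_map count_map -sum1_count big_mkcond -[iota 0 12]/(index_iota 0 12) big_mkord.
by apply: eq_bigr => i _ /=; case: (entry A i j && _).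
Qed.

Fixpoint bitseqs n : seq (seq bool) :=
  if n is n'.+1 then [seq b :: s | b <- [:: true; false], s <- bitseqs n'] else [:: [::]].

Lemma mem_bitseqs s : s \in bitseqs (size s).
Proof.
elim: s => //= b s IH; rewrite cats0 mem_cat.
by apply/orP; case: b; [left | right]; apply: map_f.
Qed.

(** [next] is the cyclic successor in [p], so the closing edge is included. *)
Definition cycle_edges (p : seq nat) :=
  [seq (next p e.1 == e.2) || (next p e.2 == e.1) | e <- edges].

(* Any two of these 5-cycles of K5 share exactly two edges. The other six 5-cycles are their
   images under an odd permutation of the vertices, here the transposition of 0 and 1. *)
Definition pentagons := [:: [:: 0; 3; 2; 1; 4]; [:: 0; 2; 1; 3; 4]; [:: 0; 2; 4; 1; 3];
  [:: 0; 1; 3; 2; 4]; [:: 0; 1; 2; 4; 3]; [:: 0; 1; 4; 3; 2]].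

Definition swap01 k := if k is 0 then 1 else if k is 1 then 0 else k.

Definition cyclesA := [seq cycle_edges p | p <- pentagons].
Definition cyclesB := [seq cycle_edges (map swap01 p) | p <- pentagons].

(** The edges selected by [w] form a 2-regular graph on five vertices, too few for two disjoint
    cycles, hence a 5-cycle. The proof inspects all 2^10 selections. *)
Lemma two_regular_pentagon w : size w = 10 -> (forall k, k < 5 -> share (star k) w = 2) ->
  (w \in cyclesA) || (w \in cyclesB).
Proof.
move=> w10 w2; have /allP/(_ w) : all (fun w =>
    all (fun k => share (star k) w == 2) (iota 0 5) ==> (w \in cyclesA) || (w \in cyclesB))
  (bitseqs 10) by vm_compute.
rewrite -w10 mem_bitseqs => /(_ isT)/implyP; apply.
by apply/allP=> k; rewrite mem_iota => /w2->.
Qed.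

(** No cycle of one class shares exactly two edges with a cycle of the other. *)
Lemma share2_same_class u v cs : cs = cyclesA \/ cs = cyclesB ->
  u \in cs -> (v \in cyclesA) || (v \in cyclesB) -> share u v = 2 -> v \in cs.
Proof.
have /allP sep : all (fun u => all (fun v => share u v != 2) cyclesB) cyclesA by vm_compute.
have /allP sep' : all (fun u => all (fun v => share u v != 2) cyclesA) cyclesB by vm_compute.
case=> -> ucs /orP[] vcs uv; [exact: vcs | | | exact: vcs].
  by case/negP: (allP (sep _ ucs) _ vcs); apply/eqP.
by case/negP: (allP (sep' _ ucs) _ vcs); apply/eqP.
Qed.

(** * The two standard arrays and their equivalence *)

Definition std_cols (cs : seq (seq bool)) :=
  [seq true :: true :: star k | k <- iota 0 5] ++ [seq true :: false :: w | w <- cs].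

Definition mx_of_cols (cs : seq (seq bool)) : 'M[bool]_(12, 11) :=
  (\matrix_(i, j) nth false (nth [::] cs j) i)%R.

(** Membership suffices: the 11 columns of [B] are distinct, so they exhaust a list of length 11. *)
Lemma mx_equiv_col_seqs B cs : covering3 B -> size cs = 11 ->
  (forall j, j < 11 -> col_seq B j \in cs) -> mx_equiv (mx_of_cols cs) B.
Proof.
move=> covB cs11 Bcs; apply: mx_equiv_cols (col_inj covB) _ => j.
have := Bcs j (ltn_ord j); rewrite -index_mem cs11 => j11.
exists (Ordinal j11); apply/colP=> i; rewrite !mxE nth_index ?Bcs //.
by rewrite (nth_map 0) ?size_iota // nth_iota // add0n entryE.
Qed.

Lemma exists_std A : covering3 A ->
  exists2 cs, cs = cyclesA \/ cs = cyclesB & mx_equiv (mx_of_cols (std_cols cs)) A.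
Proof.
move=> covA; have [B AB B0] := exists_row0 A.
have [C [BC C0 C1]] := exists_row1 (covering3_equiv AB covA) B0.
have AC := mx_equiv_trans AB BC.
have [D [CD D5 D6]] := exists_edge_rows (covering3_equiv AC covA) C0 C1.
have AD := mx_equiv_trans AC CD; have covD := covering3_equiv AD covA.
pose w j := drop 2 (col_seq D j).
have wE j : 5 <= j < 11 -> col_seq D j = true :: false :: w j.
  by move=> /D6[v Dj]; rewrite /w Dj /= drop0.
have wP j : 5 <= j < 11 -> (w j \in cyclesA) || (w j \in cyclesB).
  move=> j6; apply: two_regular_pentagon => [|k k5]; first by rewrite size_drop size_map size_iota.
  have /andP[j5 j11] := j6.
  (* Of the three shared ones, row 0 carries one and row 1 none, which leaves two edges at vertex
     [k]. *)
  have := share_col_seq covD (ltn_trans k5 _) j11 (negbT (ltn_eqF (leq_trans k5 j5))).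
  by rewrite D5 // wE // /share /= => /(_ isT) [].
have w2 j : 5 < j < 11 -> share (w 5) (w j) = 2.
  move=> /andP[j5 j11].
  have := share_col_seq covD (isT : 5 < 11) j11 (negbT (ltn_eqF j5)).
  by rewrite !wE ?j11 ?(ltnW j5) // /share /= => -[].
(* The class of column 5 decides that of all the later columns. *)
have [cs csP w5] : exists2 cs, cs = cyclesA \/ cs = cyclesB & w 5 \in cs.
  by case/orP: (wP 5 isT) => w5; [exists cyclesA => //; left | exists cyclesB => //; right].
exists cs => //; apply: mx_equiv_trans (mx_equiv_sym AD).
apply: mx_equiv_col_seqs => // [|j j11].
  by case: csP => ->.
rewrite mem_cat; apply/orP; have [j5|j5] := ltnP j 5.
  by left; rewrite D5 // (map_f (fun k => true :: true :: star k)) // mem_iota.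
right; rewrite wE ?j5 // (map_f (fun v => true :: false :: v)) //.
have [<- //|j5'] := eqVneq 5 j.
by apply: share2_same_class csP w5 (wP _ _) (w2 _ _); rewrite ?j5 // ltn_neqAle j5' j5.
Qed.

Lemma covering3_std : covering3 (mx_of_cols (std_cols cyclesA)).
Proof.
pose c j i := nth false (nth [::] (std_cols cyclesA) j) i.
have bools b : b \in [:: true; false] by case: b.
have cov : all (fun j => all (fun k => all (fun l => uniq [:: j; k; l] ==>
    all (fun x => all (fun y => all (fun z =>
      has (fun i => [&& c j i == x, c k i == y & c l i == z]) (iota 0 12))
    [:: true; false]) [:: true; false]) [:: true; false])
  (iota 0 11)) (iota 0 11)) (iota 0 11) by vm_compute.
have in11 (j : 'I_11) : (j : nat) \in iota 0 11 by rewrite mem_iota /=.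
move=> j k l jkl x y z.
move/allP/(_ _ (in11 j))/allP/(_ _ (in11 k))/allP/(_ _ (in11 l))/implyP: cov.
have jkl' : uniq [:: j : nat; k : nat; l : nat] by rewrite -(map_inj_uniq val_inj) in jkl.
move/(_ jkl')/allP/(_ _ (bools x))/allP/(_ _ (bools y))/allP/(_ _ (bools z))/hasP.
case=> i; rewrite mem_iota => i12 /and3P[/eqP ij /eqP ik /eqP il].
by exists (Ordinal i12); rewrite !mxE.
Qed.

(** Rows 3 to 5 hold the edges from 0 to 2, 3, 4, and rows 6 to 8 those from 1. *)
Definition swap_rows := [:: 0; 1; 2; 6; 7; 8; 3; 4; 5; 9; 10; 11].

(* Swapping the vertices 0 and 1 of K5 permutes the edges, and so the rows, by [swap_rows]. *)
Lemma mx_equiv_std :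
  mx_equiv (mx_of_cols (std_cols cyclesB)) (mx_of_cols (std_cols cyclesA)).
Proof.
set MA := mx_of_cols (std_cols cyclesA).
have [i|i j k /= ki kj|s sP] := @perm_of_rel 'I_12 (fun i k => k = nth 0 swap_rows i :> nat).
- exists (inord (nth 0 swap_rows i)); rewrite inordK //.
  have /allP-> // : all (fun k => k < 12) swap_rows by [].
  by rewrite mem_nth.
- have : nth 0 swap_rows i == nth 0 swap_rows j by rewrite -ki -kj.
  by rewrite nth_uniq // => /eqP/val_inj.
have MAs : mx_equiv MA (row_perm s MA) by exact/mx_equiv_row_perm/mx_equiv_refl.
apply: mx_equiv_trans (mx_equiv_sym MAs).
apply: mx_equiv_col_seqs => // [|j j11]; first exact: covering3_equiv MAs covering3_std.
have -> : col_seq (row_perm s MA) j =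
    [seq nth false (nth [::] (std_cols cyclesA) j) i | i <- swap_rows].
  rewrite -[swap_rows](mkseq_nth 0) /mkseq -map_comp; apply/eq_in_map=> i.
  by rewrite mem_iota => i12; rewrite /entry !mxE sP !inordK.
have /allP-> // : all (fun j => [seq nth false (nth [::] (std_cols cyclesA) j) i | i <- swap_rows]
  \in std_cols cyclesB) (iota 0 11) by vm_compute.
by rewrite mem_iota.
Qed.

Theorem theorem5p5 :
  (exists A : 'M[bool]_(12, 11), covering_array 3 A) /\
  (forall A B : 'M[bool]_(12, 11),
     covering_array 3 A -> covering_array 3 B -> mx_equiv A B).
Proof.
split; first by exists (mx_of_cols (std_cols cyclesA)); apply/covering3P/covering3_std.
have std A : covering_array 3 A -> mx_equiv A (mx_of_cols (std_cols cyclesA)).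
  case/covering3P/exists_std=> cs [] -> /mx_equiv_sym // AB.
  (* Only the class [cyclesB] is left here. *)
  exact: mx_equiv_trans AB mx_equiv_std.
by move=> A B /std AS /std /mx_equiv_sym; apply: mx_equiv_trans.
Qed.
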